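(* Let $G$ be a finite group, $Y$ a normal subset of $G$, and $H$ a subgroup of $G$ which is a total perfect code of the Cayley sum graph $\mathrm{CS}(G,Y)$. Then: (i) $H$ is contained in $C_G(z)$, where $z$ is the unique common element of $H$ and $Y$; (ii) the core of $H$ in $G$ is contained in $C_G(y)$ for each $y\in Y$; (iii) if $Y$ is the disjoint union of the conjugacy classes $y_1^G,\dots,y_s^G$ and $H$ is normal in $G$, then $\sum_{i=1}^{s}\frac{1}{|C_G(y_i):H|}=1$; (iv) if $|Y|>1$ and $H$ is normal in $G$, then $Y$ is a union of at least two conjugacy classes of elements of $G$.
   Context: All groups are finite. A subset $Y$ of $G$ is normal if $g^{-1}Yg=Y$ for all $g\in G$. For a normal subset $Y$ of $G$, the Cayley sum graph $\mathrm{CS}(G,Y)$ is the simple graph with vertex set $G$ in which distinct vertices $g,h$ are adjacent iff $gh\in Y$. A total perfect code in a graph is a set $C$ of vertices such that every vertex of the graph has exactly one neighbour in $C$. (If $H$ is such a subgroup total perfect code, then $|H\cap Y|=1$.) The core of $H$ in $G$ is the largest normal subgroup of $G$ contained in $H$; $C_G(y)$ is the centralizer of $y$; $y^G$ is the conjugacy class of $y$.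
   Formalization: The identity is assumed not to lie in Y for the existence of the unique common element z in (i) and for (iii); otherwise both fail, e.g. G = H = Y of order 2, where H and Y share two elements and the sum in (iii) is 2. *)

(* Defs.v *)
From mathcomp Require Import all_boot all_order all_algebra all_fingroup.
Set Implicit Arguments.
Unset Strict Implicit.
Unset Printing Implicit Defensive.

Import GroupScope.

Section Graphs.

Variable T : finType.

(* A simple graph is given by its vertex set V and its adjacency relation e. *)
Definition neighbours_in (e : rel T) (C : {set T}) (v : T) : {set T} :=
  [set c in C | e v c].

Definition total_perfect_code (V : {set T}) (e : rel T) (C : {set T}) : Prop :=
  C \subset V /\ forall v, v \in V -> #|neighbours_in e C v| = 1%N.

End Graphs.

Section CayleySum.

Variable gT : finGroupType.

(* A normal subset Y of G is expressed by Y <| G, which for a mere set Y means *)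
(* Y \subset G and Y :^ g = Y for all g in G.                                  *)
(* Pitfall: loops are excluded, so Y may contain 1; then a subgroup total      *)
(* perfect code H satisfies #|H :&: Y| = 2 rather than 1 (for instance         *)
(* G = H = Y of order 2, whose graph is K_2). It is 1 exactly when 1 \notin Y. *)
Definition cayley_sum (G Y : {set gT}) : rel gT :=
  [rel g h | [&& g \in G, h \in G, g != h & g * h \in Y]].

Lemma cayley_sum_irr (G Y : {set gT}) : irreflexive (cayley_sum G Y).
Proof. by move=> g; apply/and4P => -[_ _ /eqP]. Qed.

Lemma cayley_sum_sym (G : {group gT}) (Y : {set gT}) :
  Y <| G -> symmetric (cayley_sum G Y).
Proof.
move=> /normal_norm nYG g h; rewrite /cayley_sum /= andbCA.
have [Gh|//] := boolP (h \in G); have [Gg|//] := boolP (g \in G).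
by rewrite /= eq_sym -(memJ_norm (g * h) (subsetP nYG _ Gg)) conjgE mulgA mulKg.
Qed.

End CayleySum.

(* Main.v *)
(** The neighbours of [g] in [H] are the [h != g] with [g * h] in the left coset
    [g *: H] and in [Y], so the nontrivial elements of [Y] lie in distinct left
    cosets of [H], and every such coset meets [Y].  Conjugating [y \in Y] by an
    element of a normal subgroup inside [H] stays in [Y] and in [y *: H], hence
    fixes [y].  When [1 \notin Y], [Y] is thus a transversal of [H] in [G], so
    [#|Y| = #|G : H|], and counting [Y] by classes gives (iii).  For (iv), if [H]
    is normal then the class of the nontrivial [z \in H :&: Y] stays in [H], where
    [z] is the only nontrivial element of [Y], so this class is just [z]. *)
Require Import Defs.
From mathcomp Require Import all_boot all_order all_algebra all_fingroup.

Import GroupScope.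

Section SubgroupTotalPerfectCode.

Set Implicit Arguments.
Unset Strict Implicit.

Variables (gT : finGroupType) (G H : {group gT}) (Y : {set gT}).
Hypotheses (nYG : Y <| G) (sHG : H \subset G).
Hypothesis tpcH : total_perfect_code G (cayley_sum G Y) H.

Lemma tpc_neighbour g : g \in G ->
  exists h, [/\ h \in H, g != h & g * h \in Y].
Proof.
move=> Gg; have [_ /(_ g Gg)/eqP/cards1P[h nbh]] := tpcH.
have: h \in neighbours_in (cayley_sum G Y) H g by rewrite nbh set11.
by rewrite inE /= => /andP[Hh /and4P[_ _ ngh Ygh]]; exists h.
Qed.

Lemma tpc_neighbour_uniq g h k : g \in G ->
    h \in H -> g != h -> g * h \in Y -> k \in H -> g != k -> g * k \in Y ->
  h = k.
Proof.
move=> Gg Hh ngh Ygh Hk ngk Ygk.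
have [_ /(_ g Gg)/eqP/cards1P[c nbc]] := tpcH.
have nb x : x \in H -> g != x -> g * x \in Y -> x = c.
  move=> Hx ngx Ygx; apply/set1P; rewrite -nbc inE Hx /cayley_sum.
  by rewrite /= Gg ngx Ygx (subsetP sHG).
by rewrite (nb h) // (nb k).
Qed.

(** If [x] lies in [H], so does [y], and both are neighbours of [1] in [H]. Otherwise [1] and
    [x^-1 * y] are both neighbours of [x] in [H]; no loop can arise because [x] is outside [H]. *)
Lemma tpc_coset_inj x y : x \in Y -> y \in Y -> x != 1 -> y != 1 ->
  x^-1 * y \in H -> x = y.
Proof.
move=> Yx Yy nx1 ny1 Hxy; have sYG := subsetP (normal_sub nYG).
have [Hx|nHx] := boolP (x \in H).
  have Hy : y \in H by rewrite -(groupMl _ (groupVr Hx)).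
  by apply: (@tpc_neighbour_uniq 1); rewrite ?mul1g // eq_sym.
have nxH h : h \in H -> x != h by apply: contraTneq => <-.
have /eqP : 1 = x^-1 * y.
  by apply: (@tpc_neighbour_uniq x); rewrite ?mulg1 ?mulKVg ?nxH ?sYG.
by rewrite eq_sym -eq_mulVg1 => /eqP.
Qed.

Lemma tpc_setI : exists z,
  [/\ z \in H, z \in Y, z != 1 & forall x, x \in H -> x \in Y -> x != 1 -> x = z].
Proof.
have [z [Hz nz1 Yz]] := tpc_neighbour (group1 G).
rewrite mul1g in Yz; rewrite eq_sym in nz1; exists z; split=> // x Hx Yx nx1.
by apply: tpc_coset_inj; rewrite ?groupM ?groupV.
Qed.

Lemma class_tpc y g : y \in Y -> g \in G -> y ^ g \in Y.
Proof. by move=> Yy Gg; rewrite memJ_norm // (subsetP (normal_norm nYG)). Qed.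

Lemma tpc_gcore_cent y : y \in Y -> gcore H G \subset 'C_G[y].
Proof.
move=> Yy; have sKH := gcore_sub H G.
have Gy := subsetP (normal_sub nYG) _ Yy.
rewrite subsetI (subset_trans sKH sHG); apply/subsetP=> k Kk.
have Gk := subsetP sHG _ (subsetP sKH _ Kk).
rewrite cent1C cent1E; have [->|ny1] := eqVneq y 1; first by rewrite mulg1 mul1g.
suffices /conjg_fixP/commgP/eqP : y ^ k = y by move=> ->.
(* The quotient [y^-1 * y ^ k] is the commutator [[~ y, k]], which also equals [(k^-1) ^ y * k] and
   so lies in the core, as [y] normalises it. *)
apply/esym/tpc_coset_inj; rewrite ?class_tpc // ?conjg_eq1 //.
rewrite -commgEl commgEr (subsetP sKH) // groupM // memJ_norm ?groupV //.
by rewrite (subsetP (gcore_norm H G)).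
Qed.

Lemma card_tpc : 1 \notin Y -> (#|Y| * #|H|)%N = #|G|.
Proof.
move=> nY1; have nYx x : x \in Y -> x != 1 by apply: contraTneq => ->.
rewrite -(Lagrange sHG) mulnC -card_lcosets; congr (_ * _)%N.
have -> : lcosets H G = [set lcoset H x | x in Y].
  apply/setP=> A; apply/imsetP/imsetP=> [[g Gg ->]|[x Yx ->]]; last first.
    by exists x => //; rewrite (subsetP (normal_sub nYG)).
  have [h [Hh _ Ygh]] := tpc_neighbour Gg; exists (g * h) => //.
  by rewrite !lcosetE; apply: lcoset_eqP; rewrite mem_lcoset invMg mulgKV groupV.
rewrite card_in_imset // => x y Yx Yy; rewrite !lcosetE => eqxy.
by apply: tpc_coset_inj; rewrite ?nYx // -mem_lcoset eqxy lcoset_refl.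
Qed.

(** The assumption [1 \notin Y] excludes cases such as [G = H = Y] of order 2, where the sum is
    2. *)
Lemma tpc_sum_index s (y : 'I_s -> gT) :
    1 \notin Y -> Y = \bigcup_(i < s) (y i ^: G) ->
    (forall i j, i != j -> [disjoint y i ^: G & y j ^: G]) ->
    H <| G ->
  (\sum_(i < s) (#|'C_G[y i] : H|%:R : rat)^-1 = 1)%R.
Proof.
move=> nY1 defY dis nHG.
have sHC i : H \subset 'C_G[y i].
  apply: subset_trans (tpc_gcore_cent _).
    exact: gcore_max (normal_norm nHG).
  by rewrite defY; apply/bigcupP; exists i; rewrite ?class_refl.
have cardY : #|Y| = (\sum_(i < s) #|y i ^: G|)%N.
  rewrite -sum1_card defY partition_disjoint_bigcup //.
  by apply: eq_bigr => i _; rewrite sum1_card.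
have Y_neq0 : (#|Y|%:R != 0 :> rat)%R.
  rewrite Num.Theory.pnatr_eq0 -lt0n -(ltn_pmul2r (cardG_gt0 H)).
  by rewrite card_tpc // mul0n.
(* Writing 1 as [#|Y| / #|Y|] and splitting the numerator by classes reduces the claim to one term:
   the class size over [#|Y| = #|G : H|]. *)
rewrite -[RHS](GRing.mulfV Y_neq0) {1}cardY GRing.natr_sum GRing.mulr_suml.
apply: eq_bigr => i _; rewrite -index_cent1.
have defI : (#|G : 'C_G[y i]| * #|'C_G[y i] : H|)%N = #|Y|.
  rewrite Lagrange_index ?subsetIl ?sHC //; apply/eqP.
  by rewrite -(eqn_pmul2r (cardG_gt0 H)) card_tpc // mulnC Lagrange.
have I_neq0 : (#|G : 'C_G[y i]|%:R != 0 :> rat)%R.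
  by rewrite Num.Theory.pnatr_eq0 -lt0n indexg_gt0.
by rewrite -defI GRing.natrM GRing.invfM GRing.mulVKf.
Qed.

Lemma tpc_two_classes : 1 < #|Y| -> H <| G ->
  exists P : {set {set gT}}, [/\ P \subset classes G, 1 < #|P| & Y = cover P].
Proof.
move=> Y_gt1 nHG; have [z [Hz Yz nz1 zP]] := tpc_setI.
have sYG := subsetP (normal_sub nYG).
exists [set y ^: G | y in Y]; split.
- by apply/subsetP=> _ /imsetP[y Yy ->]; rewrite mem_classes ?sYG.
- have [y Yy nyz] : exists2 y, y \in Y & y != z.
    apply/exists_inP; apply: contraLR Y_gt1; rewrite negb_exists_in -leqNgt.
    move/forall_inP=> Yz1; rewrite -(cards1 z) subset_leq_card //.
    by apply/subsetP=> x /Yz1; rewrite negbK inE.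
  apply: (@leq_trans #|[set y ^: G; z ^: G]|); last first.
    by apply/subset_leq_card/subsetP=> A /set2P[]->; apply: imset_f.
  rewrite cards2; case: eqVneq => // eqyz.
  (* Here [y] may a priori be 1; being conjugate to [z] makes it nontrivial and, by normality of
     [H], puts it in [H], so [y = z]. *)
  have /imsetP[g Gg defy] : y \in z ^: G by rewrite -eqyz class_refl.
  case/eqP: nyz; apply: zP => //; last by rewrite defy conjg_eq1.
  by rewrite defy memJ_norm // (subsetP (normal_norm nHG)).
rewrite cover_imset; apply/setP=> x; apply/idP/bigcupP=> [Yx|[y Yy]].
  by exists x; rewrite ?class_refl.
by case/imsetP=> g Gg ->; apply: class_tpc.
Qed.

End SubgroupTotalPerfectCode.

Theorem theorem4p4 (gT : finGroupType) (G H : {group gT}) (Y : {set gT})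
    (nYG : Y <| G) (sHG : H \subset G)
    (tpcH : total_perfect_code G (cayley_sum G Y) H) :
  [/\ (1 \notin Y -> exists z, H :&: Y = [set z])
        /\ (forall z, H :&: Y = [set z] -> H \subset 'C_G[z]),
      forall y, y \in Y -> gcore H G \subset 'C_G[y],
      forall (s : nat) (y : 'I_s -> gT),
        1 \notin Y ->
        Y = \bigcup_(i < s) (y i ^: G) ->
        (forall i j, i != j -> [disjoint y i ^: G & y j ^: G]) ->
        H <| G ->
        (\sum_(i < s) (#|'C_G[y i] : H|%:R : rat)^-1 = 1)%R
    & 1 < #|Y| -> H <| G ->
        exists P : {set {set gT}},
          [/\ P \subset classes G, 1 < #|P| & Y = cover P]].
Proof.
split.
- split=> [nY1|z defz].
    have [z [Hz Yz _ zP]] := tpc_setI nYG sHG tpcH; exists z.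
    apply/setP=> x; rewrite !inE; apply/andP/eqP=> [[Hx Yx]|->] //.
    by apply: zP => //; apply: contraNneq nY1 => <-.
  have /setIP[Hz Yz] : z \in H :&: Y by rewrite defz set11.
  rewrite subsetI sHG; apply/subsetP=> h Hh; rewrite cent1C cent1E.
  (* Conjugation by [h] preserves both [H] and [Y], hence their singleton intersection. *)
  suffices /conjg_fixP/commgP/eqP : z ^ h = z by move=> ->.
  apply/set1P; rewrite -defz inE groupJ //.
  by rewrite (class_tpc nYG) ?(subsetP sHG).
- exact: tpc_gcore_cent.
- exact: tpc_sum_index.
exact: tpc_two_classes.
Qed.
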